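(* For a pair $(W,V)$ of closed manifolds of dimensions $6$ and $3$, the function $\sigma_{W,V}:\mathcal{E}_{W,V}\to\mathbb{Q}$, $\sigma_{W,V}(e)=\sigma(W,V,e)$, is an invariant of the isomorphism class of $(W,V)$. That is, if $f:(W',V')\to(W,V)$ is an isomorphism of pairs of manifolds, then the pull-back $f^*:H^2(W\setminus V;\mathbb{Q})\to H^2(W'\setminus V';\mathbb{Q})$ restricts to a bijection $f^*:\mathcal{E}_{W,V}\to\mathcal{E}_{W',V'}$, and $\sigma_{W',V'}(f^*e)=\sigma_{W,V}(e)$ for every $e\in\mathcal{E}_{W,V}$.
   Context: All manifolds are smooth, oriented and compact; boundaries are oriented by the outward-normal-first convention; empty manifolds are allowed. A pair $(Z,X)$ of codimension $3$ consists of a manifold $Z$ and a properly embedded submanifold $X\subset Z$ of codimension $3$ ($\partial X\subset\partial Z$ and $X$ is transverse to $\partial Z$). An isomorphism of pairs $(Z',X')\to(Z,X)$ is an orientation preserving diffeomorphism $f:Z'\to Z$ with $f(X')=X$ as oriented submanifolds. The normal bundle $\nu_X$ is oriented by $TZ|_X\cong TX\oplus\nu_X$ and identified with a tubular neighbourhood of $X$. Let $\rho_X:\hat X=S(\nu_X)\to X$ be the unit sphere bundle, regarded as a submanifold of $Z\setminus X$, and let $F_X\subset T\hat X$ be the vertical tangent subbundle (rank $2$), oriented by $\rho_X^*\nu_X\cong\mathbb{R}\oplus F_X$, where $\mathbb{R}$ is the tautological (radial) line bundle. $e(F_X)\in H^2(\hat X;\mathbb{Z})$ is its Euler class. An $e$-class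 of $(Z,X)$ is a class $e\in H^2(Z\setminus X;\mathbb{Q})$ with $e|_{\hat X}=e(F_X)$ over $\mathbb{Q}$; then $(Z,X,e)$ is an $e$-manifold of dimension $\dim Z$, with boundary $(\partial Z,\partial X,e|_{\partial Z\setminus\partial X})$. $\mathcal{E}_{Z,X}\subset H^2(Z\setminus X;\mathbb{Q})$ is the set of all $e$-classes of $(Z,X)$. Two $e$-manifolds $(Z,X,e)$, $(Z',X',e')$ are isomorphic ($\cong$) if there is an isomorphism of pairs $f:(Z',X')\to(Z,X)$ with $f^*e=e'$. The invariant $\sigma$: for a closed $6$-dimensional $e$-manifold $\alpha$ there are a positive integer $m$ and a $7$-dimensional $e$-manifold $(Z,X,e)$ whose boundary is isomorphic to the disjoint union of $m$ copies of $\alpha$; $\sigma(\alpha)=\operatorname{Sign}(X)/m\in\mathbb{Q}$ (signature of the $4$-manifold $X$ divided by $m$), which is independent of the choices. *)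

(* Defs.v *)
From HB Require Import structures.
From mathcomp Require Import all_boot all_order all_algebra.
From mathcomp Require Import all_classical all_reals all_analysis.

Set Implicit Arguments.
Unset Strict Implicit.
Unset Printing Implicit Defensive.

Import Order.TTheory GRing.Theory Num.Theory.
Import numFieldNormedType.Exports.

Local Open Scope classical_set_scope.
Local Open Scope ring_scope.

HB.instance Definition _ (T U : ptopologicalType) := Pointed.on (T * U)%type.

Section Smooth.
Variable R : realType.

Fixpoint Ck_on (m n k : nat) (U : set 'rV[R]_m) (f : 'rV[R]_m -> 'rV[R]_n)
    : Prop :=
  match k with
  | 0 => forall x, U x -> {for x, continuous f}
  | k'.+1 => (forall x, U x -> differentiable f x) /\
             forall v, Ck_on k' U (fun x => 'D_v f x)
  end.

Definition smooth_on (m n : nat) (U : set 'rV[R]_m)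
    (f : 'rV[R]_m -> 'rV[R]_n) : Prop :=
  forall k, Ck_on k U f.

End Smooth.

(** * Oriented manifolds

    A manifold of dimension [n] is carried by a subset of a topological space
    and described by an oriented atlas.  Every abstract manifold is covered
    (take the whole space; the pointedness of the ambient space does not
    exclude the empty manifold, whose carrier is [set0]), and submanifolds and
    boundaries live in the same ambient space.  [mfd] is the raw data, the
    axioms are in [oriented_manifold]. *)
Section Manifolds.
Variable R : realType.

(* The model is [x_0 <= 0], so that the outward normal is the first coordinate
   vector: dropping x_0 from positive charts gives the boundary its
   outward-normal-first orientation.  Since all charts of an atlas are
   positive, this model is adequate in dimension at least 2 only. *)
Definition half_space (n : nat) : set 'rV[R]_n :=
  [set x | forall i, val i = 0%N -> x 0 i <= 0].

(* [chart_bd] tells whether the chart is modelled on the half space or on the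
   whole of R^n. *)
Record chart (T : Type) (n : nat) := Chart {
  chart_bd : bool;
  dom : set T;
  coord : T -> 'rV[R]_n }.

Record mfd (T : Type) (n : nat) := Mfd {
  carrier : set T;
  atlas : set (chart T n) }.

Definition model (T : Type) (n : nat) (c : chart T n) : set 'rV[R]_n :=
  if chart_bd c then half_space (n := n) else setT.

(* The last clause says that [coord c] is open onto its image and that this
   image is open in the model. *)
Definition is_chart (T : ptopologicalType) (n : nat) (M : mfd T n)
    (c : chart T n) : Prop :=
  [/\ exists2 O, open O & dom c = carrier M `&` O,
      set_inj (dom c) (coord c),
      {within dom c, continuous (coord c)} &
      forall O, open O -> exists2 O' : set 'rV[R]_n, open O' &
        coord c @` (dom c `&` O) = model c `&` O'].

(* In the charts [c] and [d], the map [f] is smooth (i.e. it extends locally to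
   a smooth map on an open subset of R^n), with positive Jacobian. *)
Definition or_smooth_in (T T' : Type) (n : nat) (c : chart T n)
    (d : chart T' n) (f : T -> T') : Prop :=
  forall p, dom c p -> dom d (f p) ->
  exists (U : set 'rV[R]_n) (g : 'rV[R]_n -> 'rV[R]_n),
    [/\ open U, U (coord c p), smooth_on U g,
        0 < \det ('J g (coord c p)) &
        forall q, dom c q -> U (coord c q) ->
          dom d (f q) /\ coord d (f q) = g (coord c q)].

Definition compatible (T : Type) (n : nat) (c d : chart T n) : Prop :=
  or_smooth_in c d id /\ or_smooth_in d c id.

Definition oriented_manifold (T : ptopologicalType) (n : nat) (M : mfd T n)
    : Prop :=
  [/\ hausdorff_space (subspace (carrier M)),
      compact (carrier M),
      forall p, carrier M p -> exists2 c, atlas M c & dom c p,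
      forall c, atlas M c -> is_chart M c &
      forall c d, atlas M c -> atlas M d -> compatible c d].

(* The charts of the maximal oriented atlas. *)
Definition positive_chart (T : ptopologicalType) (n : nat) (M : mfd T n)
    (c : chart T n) : Prop :=
  is_chart M c /\ forall d, atlas M d -> compatible c d.

Definition boundary_set (T : Type) (n : nat) (M : mfd T n.+1) : set T :=
  [set p | exists c, [/\ atlas M c, chart_bd c, dom c p & coord c p 0 0 = 0]].

Definition boundary (T : Type) (n : nat) (M : mfd T n.+1) : mfd T n :=
  Mfd (boundary_set M)
    [set d | exists2 c, atlas M c &
       d = Chart false (dom c `&` boundary_set M)
             (fun p => \row_(i < n) coord c p 0 (lift ord0 i))].

Definition or_smooth (T T' : Type) (n : nat) (M : mfd T n) (M' : mfd T' n)
    (f : T -> T') : Prop :=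
  forall c d, atlas M c -> atlas M' d -> or_smooth_in c d f.

Definition or_diffeo (T T' : Type) (n : nat) (M : mfd T n) (M' : mfd T' n)
    (f : T -> T') : Prop :=
  exists g : T' -> T,
    [/\ set_fun (carrier M) (carrier M') f /\
        set_fun (carrier M') (carrier M) g,
        forall p, carrier M p -> g (f p) = p,
        forall q, carrier M' q -> f (g q) = q,
        or_smooth M M' f & or_smooth M' M g].

Definition copies (T : Type) (n m : nat) (M : mfd T n) : mfd (nat * T)%type n :=
  Mfd [set u : nat * T | (u.1 < m)%N /\ carrier M u.2]
    [set d : chart (nat * T)%type n | exists i c, [/\ (i < m)%N, atlas M c &
       d = Chart (chart_bd c) [set u : nat * T | u.1 = i /\ dom c u.2]
             (fun u => coord c u.2)]].

(** ** Pairs of codimension 3 *)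

(* Restriction to [A] of the first [n] coordinates. *)
Definition head_chart (T : Type) (n : nat) (c : chart T (n + 3)) (A : set T)
    : chart T n :=
  Chart (chart_bd c) (dom c `&` A) (fun q => lsubmx (coord c q)).

Definition tail (T : Type) (n : nat) (c : chart T (n + 3)) (q : T)
    : 'rV[R]_3 := rsubmx (coord c q).

(* [X] is cut out by the last three coordinates of charts of [Z]; as the
   half-space coordinate is the first one, this includes dX = X /\ dZ and
   transversality to dZ.  The orientation of [X] is not constrained by
   requiring both charts to be positive: this only fixes that of the normal
   coordinates, and amounts to TZ = TX (+) nu as oriented bundles. *)
Definition is_pair (T : ptopologicalType) (n : nat) (Z : mfd T (n + 3))
    (X : mfd T n) : Prop :=
  [/\ oriented_manifold Z, oriented_manifold X, carrier X `<=` carrier Z &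
      forall p, carrier X p -> exists c : chart T (n + 3),
        [/\ positive_chart Z c, dom c p,
            forall q, dom c q -> (carrier X q <-> tail c q = 0) &
            positive_chart X (head_chart c (carrier X))]].

Definition iso_pair (T' T : ptopologicalType) (n : nat)
    (Z' : mfd T' (n + 3)) (X' : mfd T' n)
    (Z : mfd T (n + 3)) (X : mfd T n) (f : T' -> T) : Prop :=
  [/\ or_diffeo Z' Z f, f @` carrier X' = carrier X & or_diffeo X' X f].

(** ** Tubular neighbourhoods

    The oriented Euclidean vector bundle nu_X is given by its total space, an
    open neighbourhood [tub_set] of [X] in [Z], its projection to [X], and
    local trivializations over chart domains of [X]: charts of [Z] of the form
    (coordinates of the base point, coordinates in the fibre). *)
Record tub (T : Type) (n : nat) := Tub {
  tub_set : set T;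
  tub_proj : T -> T;
  tub_charts : set (chart T (n + 3)) }.

Definition bundle_chart (T : ptopologicalType) (n : nat) (Z : mfd T (n + 3))
    (X : mfd T n) (N : tub T n) (c : chart T (n + 3)) : Prop :=
  [/\ positive_chart Z c /\ positive_chart X (head_chart c (carrier X)),
      dom c = [set q | tub_set N q /\ dom c (tub_proj N q)],
      forall q, dom c q ->
        lsubmx (coord c (tub_proj N q)) = lsubmx (coord c q),
      forall p, dom c p -> carrier X p -> tail c p = 0 &
      forall p (v : 'rV[R]_3), dom c p -> carrier X p ->
        exists q, [/\ dom c q, tub_proj N q = p & tail c q = v]].

(* The transition matrices [A] are orthogonal, i.e. preserve the metric of the
   fibres; they have determinant 1 because the charts are positive. *)
Definition tubular (T : ptopologicalType) (n : nat) (Z : mfd T (n + 3))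
    (X : mfd T n) (N : tub T n) : Prop :=
  [/\ carrier X `<=` tub_set N,
      forall q, tub_set N q -> carrier X (tub_proj N q),
      forall q, tub_set N q -> exists2 c, tub_charts N c & dom c q,
      forall c, tub_charts N c -> bundle_chart Z X N c &
      forall c d p, tub_charts N c -> tub_charts N d ->
        carrier X p -> dom c p -> dom d p ->
        exists A : 'M[R]_3, A *m A^T = 1%:M /\
          forall q, tub_set N q -> tub_proj N q = p ->
            tail d q = tail c q *m A].

Definition sphere_bundle (T : Type) (n : nat) (N : tub T n) : set T :=
  [set q | exists c, [/\ tub_charts N c, dom c q &
                         tail c q *m (tail c q)^T = 1%:M]].

(* The total space of F_X: the vectors tangent at [p] to the unit sphere of
   the fibre through [p] are the vectors of that fibre orthogonal to [p]. *)
Definition vertical_bundle (T : Type) (n : nat) (N : tub T n)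
    : set (T * T) :=
  [set u | [/\ sphere_bundle N u.1, tub_set N u.2,
               tub_proj N u.2 = tub_proj N u.1 &
               exists c, [/\ tub_charts N c, dom c u.1 &
                             tail c u.2 *m (tail c u.1)^T = 0]]].

Definition vertical_bundle_nz (T : Type) (n : nat) (N : tub T n)
    : set (T * T) :=
  vertical_bundle N `&` [set u | u.2 <> tub_proj N u.1].

Definition zero_section (T : Type) (n : nat) (N : tub T n) (p : T) : T * T :=
  (p, tub_proj N p).

End Manifolds.

(** * Singular cohomology

    A singular [k]-simplex of [A] is a function on the whole of R^(k+1) whose
    values outside the standard simplex are set to [point].  Cochains of [A]
    are functions defined on all functions R^(k+1) -> T, of which only the
    values on the singular simplices of [A] matter; [cohomologous] identifies
    cochains which agree on the latter. *)
Section Cohomology.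
Variable R : realType.

Definition std_simplex (k : nat) : set 'rV[R]_k.+1 :=
  [set x | (forall i, 0 <= x 0 i) /\ \sum_i x 0 i = 1].

(* The affine map which sends the vertex [i] to the vertex [theta i]. *)
Definition vertex_map (k m : nat) (theta : nat -> nat) (x : 'rV[R]_k.+1)
    : 'rV[R]_m.+1 :=
  \row_(j < m.+1) \sum_(i < k.+1 | theta i == j) x 0 i.

Definition simplex (T : Type) (k : nat) := 'rV[R]_k.+1 -> T.

Definition normalize (T : pointedType) (k : nat) (s : simplex T k)
    : simplex T k := patch (fun=> point) (@std_simplex k) s.

Definition singular (T : ptopologicalType) (A : set T) (k : nat)
    (s : simplex T k) : Prop :=
  [/\ {within @std_simplex k, continuous s},
      s @` @std_simplex k `<=` A &
      forall x, ~ std_simplex x -> s x = point].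

Definition cochain (T : Type) (k : nat) (G : Type) := simplex T k -> G.

Definition coboundary (T : pointedType) (k : nat) (G : pzRingType)
    (phi : cochain T k G) : cochain T k.+1 G :=
  fun s => \sum_(i < k.+2)
    (-1) ^+ i * phi (normalize (s \o @vertex_map k k.+1 (bump i))).

Definition cup (T : pointedType) (p q : nat) (G : pzRingType)
    (phi : cochain T p G) (psi : cochain T q G) : cochain T (p + q) G :=
  fun s => phi (normalize (s \o @vertex_map p (p + q) id)) *
           psi (normalize (s \o @vertex_map q (p + q) (addn p))).

Definition cocycle (T : ptopologicalType) (A : set T) (k : nat)
    (G : pzRingType) (phi : cochain T k G) : Prop :=
  forall s, singular A s -> coboundary phi s = 0.

Definition vanish_on (T : ptopologicalType) (A : set T) (k : nat)
    (G : pzRingType) (phi : cochain T k G) : Prop :=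
  forall s, singular A s -> phi s = 0.

Definition cohomologous (T : ptopologicalType) (A : set T) (k : nat)
    (G : pzRingType) (phi phi' : cochain T k.+1 G) : Prop :=
  exists psi : cochain T k G,
    forall s, singular A s -> phi s - phi' s = coboundary psi s.

Definition cohomology_class (T : ptopologicalType) (A : set T) (k : nat)
    (G : pzRingType) (phi : cochain T k.+1 G) : set (cochain T k.+1 G) :=
  [set phi' | cohomologous A phi' phi].

Definition H2 (T : ptopologicalType) (A : set T) (G : pzRingType)
    : set (set (cochain T 2 G)) :=
  [set e | exists2 phi : cochain T 2 G,
             cocycle A phi & e = cohomology_class A phi].

Definition cochain_pullback (T' T : pointedType) (f : T' -> T) (k : nat)
    (G : Type) (phi : cochain T k G) : cochain T' k G :=
  fun s => phi (normalize (f \o s)).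

(* f^* e, for a map [f] defined on [A']. *)
Definition pullback (T' T : ptopologicalType) (f : T' -> T) (A' : set T')
    (k : nat) (G : pzRingType) (e : set (cochain T k.+1 G))
    : set (cochain T' k.+1 G) :=
  [set phi' | exists2 phi, e phi &
                cohomologous A' phi' (cochain_pullback f phi)].

Arguments pullback {T' T} f A' {k G} e.

Definition restriction (T : ptopologicalType) (A : set T) (k : nat)
    (G : pzRingType) (e : set (cochain T k.+1 G)) : set (cochain T k.+1 G) :=
  pullback id A e.

Definition rationalize (T : ptopologicalType) (A : set T) (k : nat)
    (e : set (cochain T k.+1 int)) : set (cochain T k.+1 rat) :=
  [set phi' | exists2 phi, e phi & cohomologous A phi' (fun s => (phi s)%:~R)].

(** ** Affine simplices of R^n *)

(* The simplex [s] of R^n is affine with vertices the rows of [a]. *)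
Definition affine_simplex (n k : nat) (a : 'M[R]_(k.+1, n))
    (s : 'rV[R]_k.+1 -> 'rV[R]_n) : Prop :=
  forall t, std_simplex t -> s t = t *m a.

Definition in_open_simplex (n k : nat) (a : 'M[R]_(k.+1, n)) (x : 'rV[R]_n)
    : Prop :=
  exists t : 'rV[R]_k.+1,
    [/\ forall i, 0 < t 0 i, \sum_i t 0 i = 1 & x = t *m a].

Definition edges (n k : nat) (a : 'M[R]_(k.+1, n)) : 'M[R]_(k, n) :=
  \matrix_(i < k) (row (lift ord0 i) a - row ord0 a).

(** ** The Euler class of F_X *)

(* Representatives of the Thom class in H^2(F_X, F_X \ 0; Z).  The last clause
   says that it takes the value 1 on the positive generator of the relative
   homology of each fibre; a basis (v, w) of the fibre at [p] is positive if
   (p, v, w) is positive in the fibre of nu_X. *)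
Definition is_thom (T : ptopologicalType) (n : nat) (N : tub R T n)
    (u : cochain (T * T)%type 2 int) : Prop :=
  [/\ cocycle (vertical_bundle N) u,
      vanish_on (vertical_bundle_nz N) u &
      forall p c (a : 'M[R]_(2.+1, 3)) (s : simplex (T * T)%type 2),
        sphere_bundle N p -> tub_charts N c -> dom c p ->
        singular (vertical_bundle N) s ->
        (forall t, std_simplex t -> (s t).1 = p) ->
        affine_simplex a (fun t => tail c (s t).2) ->
        in_open_simplex a 0 ->
        0 < \det (col_mx (tail c p) (edges a) : 'M[R]_3) ->
        u s = 1].

Definition is_euler_class (T : ptopologicalType) (n : nat) (N : tub R T n)
    (eps : set (cochain T 2 int)) : Prop :=
  exists2 u, is_thom N u &
    eps = cohomology_class (sphere_bundle N)
            (cochain_pullback (zero_section N) u).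

Definition e_classes (T : ptopologicalType) (n : nat) (Z : mfd R T (n + 3))
    (X : mfd R T n) : set (set (cochain T 2 rat)) :=
  [set e | H2 (carrier Z `\` carrier X) e /\
     exists N eps, [/\ tubular Z X N, is_euler_class N eps &
       restriction (sphere_bundle N) e = rationalize (sphere_bundle N) eps]].

(** ** Signature *)

Record chain (T : Type) (k : nat) := Chain {
  chain_size : nat;
  chain_coef : 'I_chain_size -> rat;
  chain_simplex : 'I_chain_size -> simplex T k }.

Definition evaluate (T : Type) (k : nat) (phi : cochain T k rat)
    (z : chain T k) : rat :=
  \sum_i chain_coef i * phi (chain_simplex (c := z) i).

(* [z] represents the fundamental class in H_n(X, dX; Q), which is
   characterized by its images in the groups H_n(X, X \ p; Q).  Homology is
   tested against rational cochains: the second clause says that the boundary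
   of [z] is a chain of dX, the third one that [z] and [s] are homologous
   modulo X \ p whenever [s] is a positively oriented affine simplex in a
   chart, with [p] in its interior. *)
Definition fundamental_cycle (T : ptopologicalType) (n : nat)
    (X : mfd R T n.+1) (z : chain T n.+1) : Prop :=
  [/\ forall i, singular (carrier X) (chain_simplex (c := z) i),
      forall phi : cochain T n rat,
        vanish_on (boundary_set X) phi -> evaluate (coboundary phi) z = 0 &
      forall p c (a : 'M[R]_(n.+2, n.+1)) (s : simplex T n.+1),
        carrier X p -> ~ boundary_set X p -> atlas X c -> dom c p ->
        singular (dom c) s -> affine_simplex a (coord c \o s) ->
        in_open_simplex a (coord c p) -> 0 < \det (edges a) ->
        forall phi : cochain T n.+1 rat,
          cocycle (carrier X) phi -> vanish_on (carrier X `\ p) phi ->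
          evaluate phi z = phi s].

(* For [eps] = 1 (resp. -1): the form (x, y) |-> <x u y, [X, dX]> is positive
   (resp. negative) definite on the span in H^2(X, dX; Q) of the classes of
   [k] relative cocycles, which are then linearly independent. *)
Definition has_definite_dim (T : ptopologicalType) (X : mfd R T 4)
    (z : chain T 4) (eps : rat) (k : nat) : Prop :=
  exists b : 'I_k -> cochain T 2 rat,
    (forall i, cocycle (carrier X) (b i) /\ vanish_on (boundary_set X) (b i)) /\
    forall v : 'rV[rat]_k, v != 0 ->
      let phi : cochain T 2 rat := fun s => \sum_i v 0 i * b i s in
      0 < eps * evaluate (cup phi phi : cochain T 4 rat) z.

Definition is_max (P : nat -> Prop) (k : nat) : Prop :=
  P k /\ forall j, P j -> (j <= k)%N.

Definition is_signature (T : ptopologicalType) (X : mfd R T 4) (s : int)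
    : Prop :=
  exists z p q, [/\ fundamental_cycle X z,
    is_max (has_definite_dim X z 1) p,
    is_max (has_definite_dim X z (-1)) q & s = p%:Z - q%:Z].

(** * e-manifolds and the invariant sigma *)

Record emfd (T : Type) (n : nat) := EMfd {
  emfd_Z : mfd R T (n + 3);
  emfd_X : mfd R T n;
  emfd_e : set (cochain T 2 rat) }.

Definition is_emanifold (T : ptopologicalType) (n : nat) (a : emfd T n)
    : Prop :=
  is_pair (emfd_Z a) (emfd_X a) /\ e_classes (emfd_Z a) (emfd_X a) (emfd_e a).

Definition eboundary (T : ptopologicalType) (n : nat) (a : emfd T n.+1)
    : emfd T n :=
  let dZ := @boundary R T (n + 3) (emfd_Z a) in
  let dX := boundary (emfd_X a) in
  EMfd dZ dX (restriction (carrier dZ `\` carrier dX) (emfd_e a)).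

(* The class is pulled back by the folding map from the copies to [a]. *)
Definition ecopies (T : ptopologicalType) (n m : nat) (a : emfd T n)
    : emfd (nat * T)%type n :=
  let mZ := copies m (emfd_Z a) in
  let mX := copies m (emfd_X a) in
  EMfd mZ mX (pullback snd (carrier mZ `\` carrier mX) (emfd_e a)).

Definition eisomorphic (T' T : ptopologicalType) (n : nat) (a' : emfd T' n)
    (a : emfd T n) : Prop :=
  exists2 f : T' -> T,
    iso_pair (emfd_Z a') (emfd_X a') (emfd_Z a) (emfd_X a) f &
    pullback f (carrier (emfd_Z a') `\` carrier (emfd_X a')) (emfd_e a)
      = emfd_e a'.

(* The rational numbers Sign(X)/m computed from all possible choices. *)
Definition sigma_values (T : ptopologicalType) (a : emfd T 3) : set rat :=
  [set r | exists (m : nat) (U : ptopologicalType) (b : emfd U 4) (s : int),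
     [/\ (0 < m)%N, is_emanifold b, eisomorphic (ecopies m a) (eboundary b),
         is_signature (emfd_X b) s & r = s%:~R / m%:R]].

Definition sigma (T : ptopologicalType) (a : emfd T 3) : rat :=
  xget 0 (sigma_values a).

Definition sigma_of (T : ptopologicalType) (W : mfd R T 6) (V : mfd R T 3)
    (e : set (cochain T 2 rat)) : rat :=
  sigma (@EMfd T 3 W V e).

Definition closed_pair (T : ptopologicalType) (n : nat)
    (Z : mfd R T (n.+1 + 3)) (X : mfd R T n.+1) : Prop :=
  [/\ is_pair Z X, @boundary_set R T (n + 3) Z = set0 & boundary_set X = set0].

End Cohomology.

Arguments pullback {R T' T} f A' {k G} e.
Arguments H2 R {T} A G.

(* Main.v *)
(** Everything in sight is natural under an isomorphism of pairs [f] with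
    inverse [g].  A tubular neighbourhood [N] of [V] is carried to one of [V']
    with projection [g \o tub_proj N \o f] and charts [coord c \o f]; the map
    [f x f] pulls Thom cocycles of [N] back to Thom cocycles of the new
    neighbourhood, so [f^*] preserves e-classes, with inverse [g^*].  If
    [m] copies of [(W, V, e)] are isomorphic to the boundary of [b], then
    precomposing with [m] copies of [f] shows that [m] copies of
    [(W', V', f^* e)] are isomorphic to the boundary of the same [b]: the two
    pairs have the same set of values Sign(X)/m. *)
Require Import Defs.
From mathcomp Require Import all_boot all_order all_algebra.
From mathcomp Require Import all_classical all_reals all_analysis.

Set Implicit Arguments.
Unset Strict Implicit.
Unset Printing Implicit Defensive.

(* [coord] is also a constant of [vector]. *)
Import Defs.
Import Order.TTheory GRing.Theory Num.Theory.
Import numFieldNormedType.Exports.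

Local Open Scope classical_set_scope.
Local Open Scope ring_scope.

(** * Differential calculus on row spaces: chain rule and stability of [Ck_on] *)

Section SmoothCalculus.
Variable R : realType.
Implicit Types m n p k : nat.

Lemma derive_comp m n p (f : 'rV[R]_m -> 'rV[R]_n) (g : 'rV[R]_n -> 'rV[R]_p)
    x v :
  differentiable f x -> differentiable g (f x) ->
  'D_v (g \o f) x = 'D_v f x *m 'J g (f x).
Proof.
move=> df dg; rewrite deriveE; last exact: differentiable_comp.
by rewrite diff_comp //= -(deriveE v df) -(deriveE _ dg) deriveEjacobian.
Qed.

Lemma jacobian_comp m n p (f : 'rV[R]_m -> 'rV[R]_n)
    (g : 'rV[R]_n -> 'rV[R]_p) x :
  differentiable f x -> differentiable g (f x) ->
  'J (g \o f) x = 'J f x *m 'J g (f x).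
Proof.
move=> df dg; apply/row_matrixP => i; rewrite !rowE mulmxA.
rewrite -deriveEjacobian; last exact: differentiable_comp.
by rewrite derive_comp // deriveEjacobian.
Qed.

(** Scalars are kept as 1 x 1 matrices: scalar multiplication is then the bilinear map [mulmx], and
    a scalar function is a map between row spaces, to which [Ck_on] applies. *)
Lemma continuous_mul_scalar_rV n :
  continuous (fun q : 'rV[R]_1 * 'rV[R]_n => q.1 *m q.2).
Proof.
move=> q.
have -> : (fun q : 'rV[R]_1 * 'rV[R]_n => q.1 *m q.2) =
          (fun q => q.1 0 0 *: q.2).
  apply/funext => -[a b] /=; rewrite [a in LHS]mx11_scalar.
  exact: mul_scalar_mx.
apply: cvgZ; last exact: cvg_snd.
apply: (@continuous_comp _ _ _ fst (fun a : 'rV[R]_1 => a 0 0)).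
  exact: cvg_fst.
exact: coord_continuous.
Qed.

Lemma differentiable_mul_scalar_rV m n (h : 'rV[R]_m -> 'rV[R]_1)
    (G : 'rV[R]_m -> 'rV[R]_n) x :
  differentiable h x -> differentiable G x ->
  differentiable (fun y => h y *m G y) x.
Proof.
move=> dh dG.
apply: (@differentiable_comp _ _ _ _ (fun y => (h y, G y))
  (fun q : 'rV[R]_1 * 'rV[R]_n => q.1 *m q.2)).
  exact: differentiable_pair.
apply: (@differentiable_bilin _ _ _ _ (@mulmx R 1 1 n)).
exact: continuous_mul_scalar_rV.
Qed.

Lemma derive_mul_scalar_rV m n (h : 'rV[R]_m -> 'rV[R]_1)
    (G : 'rV[R]_m -> 'rV[R]_n) x v :
  differentiable h x -> differentiable G x ->
  'D_v (fun y => h y *m G y) x = h x *m 'D_v G x + 'D_v h x *m G x.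
Proof.
move=> dh dG; rewrite deriveE; last exact: differentiable_mul_scalar_rV.
rewrite (@diff_comp _ _ _ _ (fun y => (h y, G y))
  (fun q : 'rV[R]_1 * 'rV[R]_n => q.1 *m q.2)) /=; last 2 first.
- exact: differentiable_pair.
- apply: (@differentiable_bilin _ _ _ _ (@mulmx R 1 1 n)).
  exact: continuous_mul_scalar_rV.
rewrite (@diff_bilin _ _ _ _ (@mulmx R 1 1 n)); last first.
  exact: continuous_mul_scalar_rV.
by rewrite diff_pair //= !deriveE.
Qed.

Lemma sub_Ck_on m n k (U V : set 'rV[R]_m) (f : 'rV[R]_m -> 'rV[R]_n) :
  U `<=` V -> Ck_on k V f -> Ck_on k U f.
Proof.
elim: k f => [|k IH] f UV /=; first by move=> fc x /UV; exact: fc.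
by move=> [df Df]; split=> [x /UV /df //|v]; exact/IH.
Qed.

Lemma Ck_on_le m n k (U : set 'rV[R]_m) (f : 'rV[R]_m -> 'rV[R]_n) :
  Ck_on k.+1 U f -> Ck_on k U f.
Proof.
elim: k f => [|k IH] f [df Df].
  by move=> x Ux; exact/differentiable_continuous/df.
by split=> // v; exact/IH.
Qed.

Lemma near_derive_open m n (U : set 'rV[R]_m) (f g : 'rV[R]_m -> 'rV[R]_n) :
  open U -> {in U, f =1 g} -> forall v, {in U, 'D_v f =1 'D_v g}.
Proof.
move=> oU fg v x; rewrite inE => Ux; apply: near_eq_derive.
by apply: filterS (open_nbhs_nbhs (conj oU Ux)) => y Uy; apply: fg; rewrite inE.
Qed.

(** The first-order expansion of [f] at [x] is also one of [g], because the remainders agree near 0;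
    by uniqueness of the differential, ['d f x] is that of [g]. *)
Lemma near_eq_differentiable m n (f g : 'rV[R]_m -> 'rV[R]_n) x :
  {near x, f =1 g} -> differentiable f x -> differentiable g x.
Proof.
move=> fg df; have [dfc dfx] := (diff_locallyP x f).1 df.
have gx : g \o shift x = cst (g x) + 'd f x +o_ 0 id.
  apply/eqaddoP => e e0; have /eqaddoP/(_ e e0) := dfx.
  have fg0 : \forall y \near 0, f (y + x) = g (y + x).
    move: (fg); rewrite (near_shift 0); apply: filterS => y /=.
    by rewrite subr0.
  move=> H; near=> y.
  have -> : (g \o shift x - (cst (g x) + 'd f x)) y =
            (f \o shift x - (cst (f x) + 'd f x)) y.
    by rewrite !fctE /= (near fg0) // (nbhs_singleton fg).
  by near: y.
apply/diff_locallyP; rewrite (diff_unique dfc gx); by split.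
Unshelve. all: by end_near. Qed.

(** Formulas for derivatives are only available on [U]. Since [U] is open, an identity on [U] holds
    near each of its points and so passes to all iterated derivatives. *)
Lemma eq_Ck_on m n k (U : set 'rV[R]_m) (f g : 'rV[R]_m -> 'rV[R]_n) :
  open U -> {in U, f =1 g} -> Ck_on k U f -> Ck_on k U g.
Proof.
move=> oU.
have nearU h h' x : U x -> {in U, h =1 h'} ->
    {near x, (h : 'rV[R]_m -> 'rV[R]_n) =1 h'}.
  move=> Ux hh'; apply: filterS (open_nbhs_nbhs (conj oU Ux)) => y Uy.
  by apply: hh'; rewrite inE.
elim: k f g => [|k IH] f g fg.
  move=> fc x Ux; have := fc x Ux.
  rewrite /prop_for /continuous_at -(fg x) ?inE // => fx.
  have gf := near_eq_cvg (nearU _ _ _ Ux fg).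
  exact: cvg_trans (gf _) fx.
move=> [df Df]; split=> [x Ux|v].
  by apply: near_eq_differentiable (df x Ux); exact: nearU.
by apply: (IH _ _ _ (Df v)); exact: near_derive_open.
Qed.

Lemma Ck_on_sum m n k (I : Type) (r : seq I) (U : set 'rV[R]_m)
    (F : I -> 'rV[R]_m -> 'rV[R]_n) :
  open U -> (forall i, Ck_on k U (F i)) ->
  Ck_on k U (fun x => \sum_(i <- r) F i x).
Proof.
move=> oU.
have CkD f g : Ck_on k U f -> Ck_on k U g ->
    Ck_on k U (fun x => f x + g x : 'rV[R]_n).
  elim: k f g => [|k IH] f g /=.
    by move=> fc gc x Ux; apply: continuousD; [exact: fc|exact: gc].
  move=> [df Df] [dg Dg]; split=> [x Ux|v].
    by apply: differentiableD; [exact: df|exact: dg].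
  apply: (eq_Ck_on oU _ (IH _ _ (Df v) (Dg v))) => x; rewrite inE => Ux.
  by rewrite deriveD //; apply: diff_derivable; [exact: df|exact: dg].
have Ck0 : Ck_on k U (fun=> 0 : 'rV[R]_n).
  elim: k {CkD} => [|k IH] /=; first by move=> x _; exact: cst_continuous.
  split=> [x _|v]; first exact: differentiable_cst.
  by apply: (eq_Ck_on oU _ IH) => x _; rewrite derive_cst.
move=> CF; elim: r => [|i r IHr].
  by apply: (eq_Ck_on oU _ Ck0) => x _; rewrite big_nil.
by apply: (eq_Ck_on oU _ (CkD _ _ (CF i) IHr)) => x _; rewrite big_cons.
Qed.

Lemma Ck_on_mul_scalar_rV m n k (U : set 'rV[R]_m) (h : 'rV[R]_m -> 'rV[R]_1)
    (G : 'rV[R]_m -> 'rV[R]_n) :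
  open U -> Ck_on k U h -> Ck_on k U G -> Ck_on k U (fun x => h x *m G x).
Proof.
move=> oU; elim: k h G => [|k IH] h G Ch CG.
  move=> x Ux; apply: (@continuous_comp _ _ _ (fun y => (h y, G y))
    (fun q : 'rV[R]_1 * 'rV[R]_n => q.1 *m q.2)).
    exact: cvg_pair (Ch x Ux) (CG x Ux).
  exact: continuous_mul_scalar_rV.
have [[dh Dh] [dG DG]] := (Ch, CG); split=> [x Ux|v].
  by apply: differentiable_mul_scalar_rV; [exact: dh|exact: dG].
(* The two terms of the Leibniz rule, indexed by a boolean so that [Ck_on_sum] applies. In each of
   them the factor that is not differentiated is lowered to class [k] by [Ck_on_le]. *)
pose F (b : bool) x := if b then h x *m 'D_v G x else 'D_v h x *m G x.
have CF b : Ck_on k U (F b).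
  case: b; first exact: IH (Ck_on_le Ch) (DG v).
  exact: IH (Dh v) (Ck_on_le CG).
apply: (eq_Ck_on oU _ (Ck_on_sum [:: true; false] oU CF)) => x.
rewrite inE => Ux; rewrite big_cons big_seq1 /F derive_mul_scalar_rV //.
  exact: dh.
exact: dG.
Qed.

(** The directional derivative of [L \o f] is [L] composed with that of [f], so the induction stays
    among functions of this form. It is applied below to the extraction of a coordinate by [col]. *)
Lemma Ck_on_linear m n p k (U : set 'rV[R]_m) (f : 'rV[R]_m -> 'rV[R]_n)
    (L : {linear 'rV[R]_n -> 'rV[R]_p}) :
  open U -> continuous L -> Ck_on k U f -> Ck_on k U (L \o f).
Proof.
move=> oU cL; elim: k f => [|k IH] f.
  by move=> fc x Ux; apply: continuous_comp; [exact: fc|exact: cL].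
move=> [df Df]; split=> [x Ux|v].
  by apply: differentiable_comp; [exact: df|exact: linear_differentiable].
apply: (eq_Ck_on oU _ (IH _ (Df v))) => x; rewrite inE => Ux /=.
have dL : differentiable L (f x) by exact: linear_differentiable.
rewrite [RHS]deriveE; last by apply: differentiable_comp => //; exact: df.
rewrite diff_comp //=; last exact: df.
by rewrite diff_lin // -deriveE //; exact: df.
Qed.

Lemma continuous_col m n (j : 'I_n) :
  continuous (@col R m n j).
Proof.
move=> u A /nbhs_ballP[e /= e0 eA].
apply/nbhs_ballP; exists e => //= v [_ uv]; apply: eA; split => // i k.
by rewrite !mxE; exact: uv.
Qed.

(** Induction on [k] for all [g] at once: the derivatives of [g \o f] involve the partial
    derivatives of [g], composed with the same [f]. *)
Lemma Ck_on_comp m n p k (U : set 'rV[R]_m) (V : set 'rV[R]_n)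
    (f : 'rV[R]_m -> 'rV[R]_n) (g : 'rV[R]_n -> 'rV[R]_p) :
  open U -> (forall x, U x -> V (f x)) ->
  Ck_on k U f -> Ck_on k V g -> Ck_on k U (g \o f).
Proof.
move=> oU fUV; elim: k g => [|k IH] g.
  by move=> fc gc x Ux; apply: continuous_comp; [exact: fc|exact/gc/fUV].
move=> Cf Cg; have [[df Df] [dg Dg]] := (Cf, Cg); split=> [x Ux|v].
  by apply: differentiable_comp; [exact: df|exact/dg/fUV].
(* Chain rule in coordinates: the [i]-th coordinate of ['D_v f x], as a 1 x 1 matrix, times the
   [i]-th partial derivative of [g] at [f x]. The sum over [i] is the derivative of [g \o f]. *)
pose F i x := col i ('D_v f x) *m 'D_(delta_mx 0 i) g (f x).
have CF i : Ck_on k U (F i).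
  apply: Ck_on_mul_scalar_rV => //.
    apply: (Ck_on_linear (L := @col R 1 n i)) (Df v) => // M.
    exact: continuous_col.
  by apply: (IH (fun y => 'D_(delta_mx 0 i) g y)) (Dg _); exact: Ck_on_le.
apply: (eq_Ck_on oU _ (Ck_on_sum (index_enum _) oU CF)) => x.
rewrite inE => Ux; rewrite (derive_comp v (df x Ux) (dg _ (fUV _ Ux))).
rewrite mulmx_sum_row; apply: eq_bigr => i _; rewrite /F.
rewrite (deriveEjacobian _ (dg _ (fUV _ Ux))) -rowE.
rewrite [col _ _ in LHS]mx11_scalar mul_scalar_mx; congr (_ *: _).
by rewrite !mxE.
Qed.

Lemma smooth_on_comp m n p (U : set 'rV[R]_m) (V : set 'rV[R]_n)
    (f : 'rV[R]_m -> 'rV[R]_n) (g : 'rV[R]_n -> 'rV[R]_p) :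
  open U -> (forall x, U x -> V (f x)) ->
  smooth_on U f -> smooth_on V g -> smooth_on U (g \o f).
Proof. by move=> oU fUV Cf Cg k; exact: Ck_on_comp (Cf k) (Cg k). Qed.

Lemma smooth_on_id n (U : set 'rV[R]_n) : smooth_on U id.
Proof.
have Ck_cst k (a : 'rV[R]_n) : Ck_on k U (fun=> a).
  elim: k a => [|k IH] a; first by move=> x _; exact: cst_continuous.
  split=> [x _|v]; first exact: differentiable_cst.
  have -> : (fun x => 'D_v (fun=> a) x) = (fun=> 0 : 'rV[R]_n).
    by apply/funext => x; exact: derive_cst.
  exact: IH.
case=> [|k]; first by move=> x _; exact: cvg_id.
split=> [x _|v]; first exact: ex_diff.
have -> : (fun x => 'D_v id x) = (fun=> v : 'rV[R]_n).
  by apply/funext => x; exact: derive_id.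
exact: Ck_cst.
Qed.

Lemma jacobian_id n (x : 'rV[R]_n) : 'J id x = 1%:M.
Proof.
apply/row_matrixP => i; rewrite !rowE -deriveEjacobian; last exact: ex_diff.
by rewrite derive_id mulmx1.
Qed.

End SmoothCalculus.

(** * Continuity on subsets *)

Lemma within_continuousP (T U : topologicalType) (A : set T) (f : T -> U) :
  {within A, continuous f} <->
  forall x, A x -> forall O, open O -> O (f x) ->
    exists P, [/\ open P, P x & forall y, A y -> P y -> O (f y)].
Proof.
rewrite subspace_continuousP; split=> [cf x Ax O oO Ofx|cf x Ax O].
  have := cf x Ax O (open_nbhs_nbhs (conj oO Ofx)).
  rewrite nbhsE; case=> [P [oP Px] PO].
  by exists P; split=> // y Ay Py; exact: PO.
rewrite nbhsE; case=> [V [oV Vfx] VO].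
have [P [oP Px PO]] := cf x Ax _ oV Vfx.
apply: filterS (open_nbhs_nbhs (conj oP Px)) => y Py Ay.
exact/VO/PO.
Qed.

Lemma within_continuous_preimage (T U : topologicalType) (A : set T)
    (f : T -> U) (O : set U) :
  {within A, continuous f} -> open O ->
  exists2 P, open P & A `&` f @^-1` O = A `&` P.
Proof.
move=> /continuousP cf oO; have /open_subspaceP[P oP PE] := cf O oO.
exists P; first exact: oP.
by rewrite setIC -PE setIC.
Qed.

Lemma within_continuous_comp (T U V : topologicalType) (A : set T) (B : set U)
    (f : T -> U) (g : U -> V) :
  set_fun A B f -> {within A, continuous f} -> {within B, continuous g} ->
  {within A, continuous (g \o f)}.
Proof.
move=> fAB /within_continuousP cf /within_continuousP cg.
apply/within_continuousP => x Ax O oO Ogfx.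
have [P [oP Pfx PO]] := cg _ (fAB x Ax) O oO Ogfx.
have [Q [oQ Qx QP]] := cf _ Ax P oP Pfx.
exists Q; split=> // y Ay Qy.
exact: PO (fAB _ Ay) (QP _ Ay Qy).
Qed.

Lemma eq_within_continuous (T U : topologicalType) (A : set T) (f g : T -> U) :
  {in A, f =1 g} -> {within A, continuous f} -> {within A, continuous g}.
Proof. by move=> fg; exact: subspace_eq_continuous. Qed.

Lemma within_continuous_pair (T U V : topologicalType) (A : set T)
    (f : T -> U) (g : T -> V) :
  {within A, continuous f} -> {within A, continuous g} ->
  {within A, continuous (fun x => (f x, g x))}.
Proof. by move=> cf cg x; exact: cvg_pair (cf x) (cg x). Qed.

(** * Oriented diffeomorphisms and the transport of charts *)

Section Diffeomorphisms.
Variable R : realType.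

(** The condition of [or_smooth_in] at a single point, isolated because the intermediate chart of a
    composition is chosen point by point. *)
Definition or_smooth_at (T T' : Type) n (c : chart R T n) (d : chart R T' n)
    (f : T -> T') (p : T) : Prop :=
  exists (U : set 'rV[R]_n) (g : 'rV[R]_n -> 'rV[R]_n),
    [/\ open U, U (coord c p), smooth_on U g,
        0 < \det ('J g (coord c p)) &
        forall q, dom c q -> U (coord c q) ->
          dom d (f q) /\ coord d (f q) = g (coord c q)].

(** The representative is [G \o F], on the part of [U] that [F] maps into [V]. Its Jacobian is a
    product of two matrices of positive determinant. *)
Lemma or_smooth_at_comp (T1 T2 T3 : Type) n (c : chart R T1 n)
    (d : chart R T2 n) (e : chart R T3 n) (f : T1 -> T2) (g : T2 -> T3) p :
  dom c p -> or_smooth_at c d f p -> or_smooth_at d e g (f p) ->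
  or_smooth_at c e (g \o f) p.
Proof.
move=> cp [U [F [oU Up sF jF FE]]] [V [G [oV Vp sG jG GE]]].
have [dfp FpE] := FE p cp Up.
exists (U `&` F @^-1` V), (G \o F); split.
- rewrite openE => x [Ux VFx]; apply: filterI.
    exact: open_nbhs_nbhs (conj oU Ux).
  exact: (sF 0%N x Ux) (open_nbhs_nbhs (conj oV VFx)).
- by split=> //=; rewrite -FpE.
- apply: (@smooth_on_comp _ _ _ _ _ V) => //.
  + rewrite openE => x [Ux VFx]; apply: filterI.
      exact: open_nbhs_nbhs (conj oU Ux).
    exact: (sF 0%N x Ux) (open_nbhs_nbhs (conj oV VFx)).
  + by move=> x [].
  + by move=> k; apply: sub_Ck_on (sF k) => x [].
- rewrite jacobian_comp; last 2 first.
  + by have [+ _] := sF 1%N; exact.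
  + by have [+ _] := sG 1%N; apply; rewrite -FpE.
  rewrite det_mulmx; apply: mulr_gt0; first exact: jF.
  by rewrite -FpE; exact: jG.
- move=> q cq [Uq Vq]; have [dfq FqE] := FE q cq Uq.
  have [|egfq GqE] := GE (f q) dfq; first by rewrite FqE.
  by split=> //=; rewrite GqE FqE.
Qed.

Lemma eq_or_smooth_at (T T' : Type) n (c : chart R T n) (d : chart R T' n)
    (f f' : T -> T') p :
  (forall q, dom c q -> f q = f' q) -> or_smooth_at c d f p ->
  or_smooth_at c d f' p.
Proof.
move=> ff' [U [F [oU Up sF jF FE]]]; exists U, F; split=> // q cq Uq.
by rewrite -ff' //; exact: FE.
Qed.

(** This is [or_diffeo] with the inverse named, so that the roles of [f] and [g] can be exchanged
    and one [g] can serve for several manifolds. *)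
Definition inverse_diffeos (T T' : Type) n (M : mfd R T n) (M' : mfd R T' n)
    (f : T -> T') (g : T' -> T) : Prop :=
  [/\ set_fun (carrier M) (carrier M') f /\ set_fun (carrier M') (carrier M) g,
      forall p, carrier M p -> g (f p) = p,
      forall q, carrier M' q -> f (g q) = q,
      or_smooth M M' f & or_smooth M' M g].

Lemma inverse_diffeos_sym (T T' : Type) n (M : mfd R T n) (M' : mfd R T' n)
    (f : T -> T') (g : T' -> T) :
  inverse_diffeos M M' f g -> inverse_diffeos M' M g f.
Proof. by move=> [[] *]; split. Qed.

(* Unlike [oriented_manifold], this holds trivially for boundaries and
   copies. *)
Definition covering_atlas (T : Type) n (M : mfd R T n) : Prop :=
  (forall p, carrier M p -> exists2 c, atlas M c & dom c p) /\
  (forall c, atlas M c -> dom c `<=` carrier M).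

Lemma oriented_covering_atlas (T : ptopologicalType) n (M : mfd R T n) :
  oriented_manifold M -> covering_atlas M.
Proof.
move=> [_ _ cov ch _]; split=> // c /ch[[B _ ->] _ _ _].
exact: subIsetl.
Qed.

Lemma or_smooth_comp (T1 T2 T3 : Type) n (M1 : mfd R T1 n) (M2 : mfd R T2 n)
    (M3 : mfd R T3 n) (f : T1 -> T2) (g : T2 -> T3) :
  covering_atlas M1 -> covering_atlas M2 ->
  set_fun (carrier M1) (carrier M2) f ->
  or_smooth M1 M2 f -> or_smooth M2 M3 g -> or_smooth M1 M3 (g \o f).
Proof.
move=> [_ M1d] [M2c _] fM sf sg c e Mc Me p cp ep.
have [d Md dfp] := M2c _ (fM _ (M1d c Mc p cp)).
by apply: (or_smooth_at_comp (d := d)) => //; [exact: sf|exact: sg].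
Qed.

Lemma inverse_diffeos_comp (T1 T2 T3 : Type) n (M1 : mfd R T1 n)
    (M2 : mfd R T2 n) (M3 : mfd R T3 n) (f : T1 -> T2) (g : T2 -> T1)
    (f' : T2 -> T3) (g' : T3 -> T2) :
  covering_atlas M1 -> covering_atlas M2 -> covering_atlas M3 ->
  inverse_diffeos M1 M2 f g -> inverse_diffeos M2 M3 f' g' ->
  inverse_diffeos M1 M3 (f' \o f) (g \o g').
Proof.
move=> c1 c2 c3 [[fM gM] gf fg sf sg] [[fM' gM'] gf' fg' sf' sg']; split.
- split=> x Mx /=; first exact/fM'/fM.
  exact/gM/gM'.
- by move=> p Mp /=; rewrite gf' ?gf //; exact: fM.
- by move=> p Mp /=; rewrite fg ?fg' //; exact: gM'.
- exact: or_smooth_comp sf sf'.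
- exact: or_smooth_comp sg' sg.
Qed.

Lemma model_coord (T : ptopologicalType) n (M : mfd R T n) c p :
  is_chart M c -> dom c p -> model c (coord c p).
Proof.
move=> [_ _ _ opn] cp; have [B _ cE] := opn setT openT.
have : (coord c @` (dom c `&` setT)) (coord c p) by exists p.
by rewrite cE => -[].
Qed.

(** Near [f p], the chart [d] identifies [O] with an open part [B'] of the model. The preimage of
    [B'] under the smooth representative [F] is open, and continuity of [coord c] brings it back to
    [M]. *)
Lemma or_smooth_continuous (T T' : ptopologicalType) n (M : mfd R T n)
    (M' : mfd R T' n) (f : T -> T') :
  oriented_manifold M -> oriented_manifold M' ->
  set_fun (carrier M) (carrier M') f -> or_smooth M M' f ->
  {within carrier M, continuous f}.
Proof.
move=> [_ _ covM chM _] [_ _ covM' chM' _] fM sf.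
apply/within_continuousP => p Mp O oO Ofp.
have [c Mc cp] := covM p Mp; have [d Md dfp] := covM' _ (fM p Mp).
have [U [F [oU Up sF _ FE]]] := sf c d Mc Md p cp dfp.
have [[B oB cE] _ /within_continuousP cc _] := chM c Mc.
have [_ dinj _ /(_ O oO)[B' oB' dE]] := chM' d Md.
have [_ FpE] := FE p cp Up.
have B'Fp : B' (F (coord c p)).
  rewrite -FpE.
  have : (coord d @` (dom d `&` O)) (coord d (f p)) by exists (f p).
  by rewrite dE => -[].
have oUF : open (U `&` F @^-1` B').
  rewrite openE => x [Ux B'Fx]; apply: filterI.
    exact: open_nbhs_nbhs (conj oU Ux).
  exact: (sF 0%N x Ux) (open_nbhs_nbhs (conj oB' B'Fx)).
have [P [oP Pp PU]] := cc p cp _ oUF (conj Up B'Fp).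
exists (P `&` B); split=> //.
- exact: openI.
- by split=> //; move: cp; rewrite cE => -[].
move=> q Mq [Pq Bq].
have cq : dom c q by rewrite cE.
have [Uq B'Fq] := PU q cq Pq; have [dfq FqE] := FE q cq Uq.
have : (model d `&` B') (coord d (f q)).
  by split; [exact: model_coord (chM' d Md) dfq|rewrite FqE].
(* Some point [z] of [O] has the same coordinates as [f q]; injectivity of [coord d] identifies the
   two. *)
rewrite -dE => -[z [dz Oz] dzE].
by rewrite -(dinj z (f q)) ?inE.
Qed.

(** Maps are total and arbitrary off the carrier, so the preimage of the domain is cut down to
    [A]. *)
Definition pull_chart (T T' : Type) n (f : T' -> T) (A : set T')
    (c : chart R T n) : chart R T' n :=
  Chart (chart_bd c) (A `&` f @^-1` dom c) (coord c \o f).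

(** Domain and continuity clauses come from continuity of [f]. For openness, the image under [f] of
    an open part of [M'] is its preimage under [g], which is open in [M] by continuity of [g]. *)
Lemma pull_chart_is_chart (T T' : ptopologicalType) n (M : mfd R T n)
    (M' : mfd R T' n) (f : T' -> T) (g : T -> T') (c : chart R T n) :
  oriented_manifold M -> oriented_manifold M' -> inverse_diffeos M' M f g ->
  is_chart M c -> is_chart M' (pull_chart f (carrier M') c).
Proof.
move=> oM oM' [[fM gM] gf fg sf sg] [[B oB cE] cinj cc opn].
have cf : {within carrier M', continuous f} by exact: or_smooth_continuous sf.
have cg : {within carrier M, continuous g} by exact: or_smooth_continuous sg.
split => /=.
- have [P oP PE] := within_continuous_preimage cf oB.
  exists P => //; rewrite -PE cE; apply/seteqP; split=> x [Mx]; last first.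
    by move=> Ox; split=> //; split=> //; exact: fM.
  by move=> [_ Ox].
- move=> x y; rewrite !inE => -[Mx cx] [My cy] xy.
  by rewrite -(gf x) // -(gf y) // (cinj (f x) (f y)) ?inE.
- apply: (within_continuous_comp (B := dom c)) => //; first by move=> x [].
  exact: continuous_subspaceW (@subIsetl _ _ _) cf.
- move=> O' oO'; have [P oP PE] := within_continuous_preimage cg oO'.
  have [Q oQ QE] := opn P oP; exists Q => //.
  (* [model] depends on a chart only through [chart_bd], which [pull_chart] copies. *)
  rewrite /model /= -/(model c) -QE; apply/seteqP; split=> [y|y].
    move=> [x [[Mx cx] O'x] <-]; exists (f x) => //; split=> //.
    by have : (carrier M `&` g @^-1` O') (f x);
      [split; [exact: fM|rewrite /= gf]|rewrite PE => -[]].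
  move=> [z [cz Pz] <-].
  have Mz : carrier M z by move: cz; rewrite cE => -[].
  have [_ O'z] : (carrier M `&` g @^-1` O') z by rewrite PE.
  exists (g z); last by rewrite /= fg.
  by split=> //; split; [exact: gM|rewrite /= fg].
Qed.

(** The transition to a chart [d'] of [M'] factors through a chart [d] of [M] around [f p]: [f] from
    [c'] to [c], the identity from [c] to [d], and [g] from [d] to [d']. Each factor has positive
    Jacobian. The opposite transition runs through [d'], [d], [c], [c']. *)
Lemma pull_chart_positive (T T' : ptopologicalType) n (M : mfd R T n)
    (M' : mfd R T' n) (f : T' -> T) (g : T -> T') (c : chart R T n) :
  oriented_manifold M -> oriented_manifold M' -> inverse_diffeos M' M f g ->
  positive_chart M c -> positive_chart M' (pull_chart f (carrier M') c).
Proof.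
move=> oM oM' fgd [ch comp]; split; first exact: pull_chart_is_chart fgd ch.
have [[fM gM] gf fg sf sg] := fgd.
have [covM domM] := oriented_covering_atlas oM.
have [covM' domM'] := oriented_covering_atlas oM'.
set c' := pull_chart _ _ _.
(* In the charts [c'] and [c], both [f] and [g] are the identity. *)
have jac_id x : 0 < \det ('J (@id 'rV[R]_n) x).
  by rewrite jacobian_id det1.
have f_at p : dom c' p -> or_smooth_at c' c f p.
  by move=> _; exists setT, id; split=> //;
    [exact: openT|exact: smooth_on_id|move=> q []].
have g_at p : dom c p -> or_smooth_at c c' g p.
  move=> _; exists setT, id; split=> // [||q cq _];
    [exact: openT|exact: smooth_on_id|].
  have Mq : carrier M q.
    by have [[B _ cE] _ _ _] := ch; move: cq; rewrite cE => -[].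
  by rewrite /= fg //; split=> //; split=> //; exact: gM.
move=> d' Md'; split=> p /=.
  move=> [Mp cp] d'p; have [d Md dfp] := covM (f p) (fM p Mp).
  suff: or_smooth_at c' d' id p by [].
  apply: (@eq_or_smooth_at _ _ _ _ _ (g \o (id \o f))).
    by move=> q [Mq _] /=; rewrite gf.
  apply: (or_smooth_at_comp (d := d)) => //.
    apply: (or_smooth_at_comp (d := c)) => //; first exact: f_at.
    by have [+ _] := comp d Md; exact.
  by apply: sg => //=; rewrite gf.
move=> d'p [Mp cp]; have [d Md dfp] := covM (f p) (fM p Mp).
suff: or_smooth_at d' c' id p by [].
apply: (@eq_or_smooth_at _ _ _ _ _ (g \o (id \o f))).
  by move=> q d'q /=; rewrite gf //; exact: domM' d'q.
apply: (or_smooth_at_comp (d := c)) => //.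
  apply: (or_smooth_at_comp (d := d)) => //; first exact: sf.
  by have [_] := comp d Md; exact.
exact: g_at.
Qed.

End Diffeomorphisms.

(** * Functoriality of singular cochains and of cohomology classes *)

Section SingularCohomology.
Variable R : realType.

(** Each source coordinate contributes to exactly one target coordinate, since [theta i] is in
    range; exchanging the two sums shows that the total remains 1. *)
Lemma vertex_map_std_simplex k m (theta : nat -> nat) (x : 'rV[R]_k.+1) :
  (forall i, (i < k.+1)%N -> (theta i < m.+1)%N) ->
  std_simplex x -> std_simplex (vertex_map m theta x).
Proof.
move=> thetaP [x0 x1]; split=> [j|]; first by rewrite mxE; exact: sumr_ge0.
rewrite -x1; under eq_bigr do rewrite mxE.
rewrite (exchange_big_dep xpredT) //=; apply: eq_bigr => i _.
rewrite (bigD1 (Ordinal (thetaP i (ltn_ord i)))) //= big1 ?addr0 //.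
by move=> j /andP[/eqP jE]; rewrite -val_eqE /= jE eqxx.
Qed.

Lemma face_std_simplex k (i : 'I_k.+2) (x : 'rV[R]_k.+1) :
  std_simplex x -> std_simplex (vertex_map k.+1 (bump i) x).
Proof.
apply: vertex_map_std_simplex => j jk; rewrite /bump.
by case: (i <= j)%N; rewrite ?add1n ?add0n ltnS // ltnW.
Qed.

Lemma eq_normalize (T : pointedType) k (s s' : simplex R T k) :
  (forall x, std_simplex x -> s x = s' x) -> normalize s = normalize s'.
Proof.
move=> ss'; apply/funext => x; rewrite /normalize /patch.
by case: ifPn => //; rewrite inE => /ss'.
Qed.

Lemma normalizeE (T : pointedType) k (s : simplex R T k) x :
  std_simplex x -> normalize s x = s x.
Proof. by move=> xs; rewrite /normalize /patch mem_set. Qed.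

Lemma normalize_singular (T : ptopologicalType) (A : set T) k
    (s : simplex R T k) : singular A s -> normalize s = s.
Proof.
move=> [_ _ s0]; apply/funext => x; have [xs|xs] := pselect (std_simplex x).
  exact: normalizeE.
by rewrite s0 // /normalize /patch memNset.
Qed.

(** Off the simplex [f \o s] takes the value [f point], which may differ from [point]; [normalize]
    resets it. *)
Lemma singular_comp (T U : ptopologicalType) (A : set T) (B : set U)
    (f : T -> U) k (s : simplex R T k) :
  set_fun A B f -> {within A, continuous f} -> singular A s ->
  singular B (normalize (f \o s)).
Proof.
move=> fAB cf [cs sA _]; split.
- apply: (@eq_within_continuous _ _ _ (f \o s)).
    by move=> x; rewrite inE => xs; rewrite normalizeE.
  by apply: within_continuous_comp cs cf => x xs; apply: sA; exists x.
- by move=> _ [x xs <-]; rewrite normalizeE //; apply/fAB/sA; exists x.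
- by move=> x xs; rewrite /normalize /patch memNset.
Qed.

(** Both sides apply [phi] to the faces of [f \o s]. They differ only in where [normalize] is
    inserted, which does not matter because face maps send the simplex into the simplex. *)
Lemma coboundary_pullback (T U : pointedType) (f : T -> U) k (G : pzRingType)
    (phi : cochain R U k G) :
  coboundary (cochain_pullback f phi) = cochain_pullback f (coboundary phi).
Proof.
apply/funext => s; apply: eq_bigr => i _; congr (_ * phi _).
apply: eq_normalize => x xs /=.
by rewrite !normalizeE //; exact: face_std_simplex.
Qed.

Lemma coboundaryD (T : pointedType) k (G : pzRingType)
    (phi psi : cochain R T k G) s :
  coboundary (fun t => phi t + psi t) s = coboundary phi s + coboundary psi s.
Proof. by rewrite -big_split; apply: eq_bigr => i _; rewrite mulrDr. Qed.

Lemma coboundaryN (T : pointedType) k (G : pzRingType)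
    (phi : cochain R T k G) s :
  coboundary (fun t => - phi t) s = - coboundary phi s.
Proof. by rewrite -sumrN; apply: eq_bigr => i _; rewrite mulrN. Qed.

Lemma coboundary0 (T : pointedType) k (G : pzRingType) s :
  coboundary (fun=> 0 : G) (s : simplex R T k.+1) = 0.
Proof. by rewrite /coboundary big1 // => i _; rewrite mulr0. Qed.

Lemma coboundary_intr (T : pointedType) k (G : pzRingType)
    (phi : cochain R T k int) s :
  coboundary (fun t => (phi t)%:~R : G) s = (coboundary phi s)%:~R.
Proof.
rewrite /coboundary rmorph_sum; apply: eq_bigr => i _.
by rewrite rmorphM rmorphXn rmorphN rmorph1.
Qed.

Section Classes.
Variables (T : ptopologicalType) (A : set T) (k : nat) (G : pzRingType).
Implicit Types phi : cochain R T k.+1 G.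

Lemma eq_cohomologous phi phi' :
  (forall s, singular A s -> phi s = phi' s) -> cohomologous A phi phi'.
Proof.
by move=> E; exists (fun=> 0) => s As; rewrite coboundary0 E // subrr.
Qed.

Lemma cohomologous_refl phi : cohomologous A phi phi.
Proof. exact: eq_cohomologous. Qed.

Lemma cohomologous_sym phi phi' :
  cohomologous A phi phi' -> cohomologous A phi' phi.
Proof.
move=> [psi E]; exists (fun s => - psi s) => s As.
by rewrite coboundaryN -E // opprB.
Qed.

Lemma cohomologous_trans phi1 phi2 phi3 :
  cohomologous A phi1 phi2 -> cohomologous A phi2 phi3 ->
  cohomologous A phi1 phi3.
Proof.
move=> [psi E] [psi' E']; exists (fun s => psi s + psi' s) => s As.
by rewrite coboundaryD -E // -E' // addrA subrK.
Qed.

Lemma cohomology_class_eqP phi phi' :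
  cohomology_class A phi = cohomology_class A phi' <-> cohomologous A phi phi'.
Proof.
split=> [E|E].
  have : cohomology_class A phi phi by exact: cohomologous_refl.
  by rewrite E.
apply/seteqP; split=> psi /= H; apply: cohomologous_trans H _ => //.
exact: cohomologous_sym.
Qed.

End Classes.

Lemma cohomologous_pullback (T U : ptopologicalType) (A : set T) (B : set U)
    (f : T -> U) k (G : pzRingType) (phi phi' : cochain R U k.+1 G) :
  set_fun A B f -> {within A, continuous f} -> cohomologous B phi phi' ->
  cohomologous A (cochain_pullback f phi) (cochain_pullback f phi').
Proof.
move=> fAB cf [psi E]; exists (cochain_pullback f psi) => s As.
by rewrite coboundary_pullback /cochain_pullback E //; exact: singular_comp As.
Qed.

Lemma eq_cochain_pullback (T U : ptopologicalType) (A : set T) (f g : T -> U)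
    k (G : pzRingType) (phi : cochain R U k G) s :
  {in A, f =1 g} -> singular A s ->
  cochain_pullback f phi s = cochain_pullback g phi s.
Proof.
move=> fg [_ sA _]; congr phi; apply: eq_normalize => x xs /=.
by apply: fg; rewrite inE; apply: sA; exists x.
Qed.

Lemma cochain_pullback_id (T : ptopologicalType) (A : set T) k (G : pzRingType)
    (phi : cochain R T k G) s :
  singular A s -> cochain_pullback id phi s = phi s.
Proof. by move=> As; congr phi; exact: normalize_singular As. Qed.

Lemma cochain_pullback_comp (T U V : pointedType) (f : T -> U) (g : U -> V)
    k (G : Type) (phi : cochain R V k G) :
  cochain_pullback f (cochain_pullback g phi) = cochain_pullback (g \o f) phi.
Proof.
apply/funext => s; congr phi; apply: eq_normalize => x xs /=.
by rewrite normalizeE.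
Qed.

Lemma cocycle_pullback (T U : ptopologicalType) (A : set T) (B : set U)
    (f : T -> U) k (G : pzRingType) (phi : cochain R U k G) :
  set_fun A B f -> {within A, continuous f} -> cocycle B phi ->
  cocycle A (cochain_pullback f phi).
Proof.
move=> fAB cf cphi s As; rewrite coboundary_pullback.
exact/cphi/(singular_comp fAB cf As).
Qed.

Lemma vanish_on_pullback (T U : ptopologicalType) (A : set T) (B : set U)
    (f : T -> U) k (G : pzRingType) (phi : cochain R U k G) :
  set_fun A B f -> {within A, continuous f} -> vanish_on B phi ->
  vanish_on A (cochain_pullback f phi).
Proof. by move=> fAB cf vphi s As; exact/vphi/(singular_comp fAB cf As). Qed.

(** Classes are sets of cochains; this lemma, with [restriction_class] and [rationalize_class],
    reduces operations on them to a single representative. *)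
Lemma pullback_class (T U : ptopologicalType) (A : set T) (B : set U)
    (f : T -> U) k (G : pzRingType) (phi : cochain R U k.+1 G) :
  set_fun A B f -> {within A, continuous f} ->
  pullback f A (cohomology_class B phi) =
  cohomology_class A (cochain_pullback f phi).
Proof.
move=> fAB cf; apply/seteqP; split=> psi /=.
  move=> [phi' phi'E psiE]; apply: cohomologous_trans psiE _.
  exact: cohomologous_pullback phi'E.
by move=> psiE; exists phi => //; exact: cohomologous_refl.
Qed.

Lemma restriction_class (T : ptopologicalType) (A B : set T) k (G : pzRingType)
    (phi : cochain R T k.+1 G) :
  A `<=` B -> restriction A (cohomology_class B phi) = cohomology_class A phi.
Proof.
move=> AB; rewrite /restriction (pullback_class (B := B)) //.
- apply/cohomology_class_eqP/eq_cohomologous => s.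
  exact: cochain_pullback_id.
- by apply: continuous_subspaceT => x; exact: cvg_id.
Qed.

Lemma rationalize_class (T : ptopologicalType) (A : set T) k
    (phi : cochain R T k.+1 int) :
  rationalize A (cohomology_class A phi) =
  cohomology_class A (fun s => (phi s)%:~R).
Proof.
apply/seteqP; split=> psi /=.
  move=> [phi' [chi E] psiE]; apply: cohomologous_trans psiE _.
  exists (fun s => (chi s)%:~R) => s As.
  by rewrite coboundary_intr -E // rmorphB.
by move=> psiE; exists phi => //; exact: cohomologous_refl.
Qed.

(** Left to right, the cohomology on [B] between representatives is pulled back along [f]. Right to
    left, [cochain_pullback g phi] itself is chosen in the inner pullback. *)
Lemma pullback_comp (T U V : ptopologicalType) (A : set T) (B : set U)
    (f : T -> U) (g : U -> V) k (G : pzRingType)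
    (e : set (cochain R V k.+1 G)) :
  set_fun A B f -> {within A, continuous f} ->
  pullback f A (pullback g B e) = pullback (g \o f) A e.
Proof.
move=> fAB cf; apply/seteqP; split=> psi /=.
  move=> [chi [phi ephi chiE] psiE]; exists phi => //.
  apply: cohomologous_trans psiE _; rewrite -(cochain_pullback_comp f g).
  exact: cohomologous_pullback chiE.
move=> [phi ephi psiE] /=; exists (cochain_pullback g phi).
  by exists phi => //; exact: cohomologous_refl.
by rewrite (cochain_pullback_comp f g).
Qed.

Lemma eq_pullback (T U : ptopologicalType) (A : set T) (f g : T -> U) k
    (G : pzRingType) (e : set (cochain R U k.+1 G)) :
  {in A, f =1 g} -> pullback f A e = pullback g A e.
Proof.
move=> fg; apply/seteqP; split=> psi [phi ephi psiE]; exists phi => //;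
  apply: cohomologous_trans psiE _; apply: eq_cohomologous => s As;
  apply: eq_cochain_pullback As => x /fg.
  exact.
exact: esym.
Qed.

(** An element of [H2] is a full cohomology class, so closing it under [cohomologous] adds
    nothing. *)
Lemma pullback_id_H2 (T : ptopologicalType) (A : set T) (G : pzRingType) e :
  H2 R A G e -> pullback id A e = e.
Proof.
move=> [phi _ ->].
exact: (@restriction_class _ _ _ _ _ _ (@subset_refl _ A)).
Qed.

Lemma H2_pullback (T U : ptopologicalType) (A : set T) (B : set U)
    (f : T -> U) (G : pzRingType) :
  set_fun A B f -> {within A, continuous f} ->
  set_fun (H2 R B G) (H2 R A G) (pullback f A).
Proof.
move=> fAB cf _ [phi cphi ->]; rewrite (pullback_class _ fAB) //.
by exists (cochain_pullback f phi) => //; exact: cocycle_pullback cphi.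
Qed.

End SingularCohomology.

(** * Isomorphisms of pairs and their inverses *)

Section Pairs.
Variable R : realType.

(** One [g] inverts [f] on both manifolds, whereas [iso_pair] provides a separate inverse on
    each. *)
Definition inverse_pair_isos (T T' : Type) n (Z : mfd R T (n + 3))
    (X : mfd R T n) (Z' : mfd R T' (n + 3)) (X' : mfd R T' n) (f : T -> T')
    (g : T' -> T) : Prop :=
  inverse_diffeos Z Z' f g /\ inverse_diffeos X X' f g.

Lemma inverse_pair_isos_sym (T T' : Type) n (Z : mfd R T (n + 3))
    (X : mfd R T n) (Z' : mfd R T' (n + 3)) (X' : mfd R T' n) (f : T -> T')
    (g : T' -> T) :
  inverse_pair_isos Z X Z' X' f g -> inverse_pair_isos Z' X' Z X g f.
Proof. by move=> [? ?]; split; exact: inverse_diffeos_sym. Qed.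

Lemma inverse_pair_isos_iso_pair (T T' : ptopologicalType) n
    (Z : mfd R T (n + 3)) (X : mfd R T n) (Z' : mfd R T' (n + 3))
    (X' : mfd R T' n) (f : T -> T') (g : T' -> T) :
  inverse_pair_isos Z X Z' X' f g -> iso_pair Z X Z' X' f.
Proof.
move=> [fgZ fgX]; split; [by exists g| |by exists g].
have [[fX gX] _ fg _ _] := fgX; apply/seteqP; split=> [_ [x Xx <-]|x Xx].
  exact: fX.
by exists (g x); [exact: gX|exact: fg].
Qed.

(* The inverses of [f] on [Z'] and on [X'] agree on [X']. *)
Lemma iso_pair_inverse (T T' : ptopologicalType) n (Z : mfd R T (n + 3))
    (X : mfd R T n) (Z' : mfd R T' (n + 3)) (X' : mfd R T' n) (f : T -> T') :
  is_pair Z X -> is_pair Z' X' -> iso_pair Z X Z' X' f ->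
  exists g, inverse_pair_isos Z X Z' X' f g.
Proof.
move=> [_ _ XZ _] [_ oX' _ _] [[g fgZ] _ [h [[fX hX] hf fh sf sh]]].
have [_ gf _ _ _] := fgZ.
have gh y : carrier X' y -> h y = g y.
  by move=> Xy; rewrite -{2}(fh y Xy) gf //; exact/XZ/hX.
have [_ domX'] := oriented_covering_atlas oX'.
exists g; split=> //; split=> //.
- by split=> // y Xy; rewrite -gh //; exact: hX.
- by move=> x Xx; rewrite gf //; exact: XZ.
- by move=> y Xy; rewrite -gh // fh.
move=> c d Xc Xd p cp; rewrite -gh; last exact: domX' cp.
move=> dp; suff: or_smooth_at c d g p by [].
apply: (eq_or_smooth_at (f := h)); last exact: sh.
by move=> q cq; exact/gh/(domX' c).
Qed.

Lemma or_diffeo_comp (T1 T2 T3 : Type) n (M1 : mfd R T1 n) (M2 : mfd R T2 n)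
    (M3 : mfd R T3 n) (f : T1 -> T2) (g : T2 -> T3) :
  covering_atlas M1 -> covering_atlas M2 -> covering_atlas M3 ->
  or_diffeo M1 M2 f -> or_diffeo M2 M3 g -> or_diffeo M1 M3 (g \o f).
Proof.
move=> c1 c2 c3 [f' ff'] [g' gg']; exists (f' \o g').
exact: (inverse_diffeos_comp c1 c2 c3 ff' gg').
Qed.

Lemma iso_pair_comp (T1 T2 T3 : ptopologicalType) n
    (Z1 : mfd R T1 (n + 3)) (X1 : mfd R T1 n) (Z2 : mfd R T2 (n + 3))
    (X2 : mfd R T2 n) (Z3 : mfd R T3 (n + 3)) (X3 : mfd R T3 n)
    (f : T1 -> T2) (g : T2 -> T3) :
  covering_atlas Z1 -> covering_atlas Z2 -> covering_atlas Z3 ->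
  covering_atlas X1 -> covering_atlas X2 -> covering_atlas X3 ->
  iso_pair Z1 X1 Z2 X2 f -> iso_pair Z2 X2 Z3 X3 g ->
  iso_pair Z1 X1 Z3 X3 (g \o f).
Proof.
move=> cZ1 cZ2 cZ3 cX1 cX2 cX3 [fZ fX dfX] [gZ gX dgX].
split; [exact: or_diffeo_comp fZ gZ| |exact: or_diffeo_comp dfX dgX].
by rewrite -image_comp fX gX.
Qed.

Definition pull_tub (T T' : Type) n (f : T' -> T) (g : T -> T') (A : set T')
    (N : tub R T n) : tub R T' n :=
  Tub (A `&` f @^-1` tub_set N) (g \o tub_proj N \o f)
    [set pull_chart f A c | c in tub_charts N].

Section TubularNeighbourhood.
Variables (T : ptopologicalType) (n : nat).
Variables (Z : mfd R T (n + 3)) (X : mfd R T n) (N : tub R T n).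
Hypothesis tubN : tubular Z X N.

Lemma tub_chart_carrier c : tub_charts N c -> dom c `<=` carrier Z.
Proof.
have [_ _ _ chN _] := tubN.
by move=> /chN[[[[[B _ ->] _ _ _] _] _] _ _ _ _] => x [].
Qed.

Lemma tub_chart_tub_set c : tub_charts N c -> dom c `<=` tub_set N.
Proof. by have [_ _ _ chN _] := tubN; move=> /chN[_ -> _ _ _] x []. Qed.

(** Normal coordinates vanish on [X] but have norm 1 on the sphere bundle. Hence classes of the
    complement of [X] restrict to the sphere bundle. *)
Lemma sphere_bundle_complement :
  sphere_bundle N `<=` carrier Z `\` carrier X.
Proof.
have [_ _ _ chN _] := tubN.
move=> x [c [Nc cx norm1]]; split; first exact: tub_chart_carrier cx.
move=> Xx; have [_ _ _ ctail _] := chN c Nc.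
move: norm1; rewrite ctail // mul0mx => /matrixP/(_ 0 0).
by rewrite !mxE eqxx => /esym/eqP; rewrite oner_eq0.
Qed.

End TubularNeighbourhood.

(** * Transport of tubular neighbourhoods, Thom cocycles and e-classes *)

Section Transport.
Variables (T T' : ptopologicalType) (n : nat).
Variables (Z : mfd R T (n + 3)) (X : mfd R T n).
Variables (Z' : mfd R T' (n + 3)) (X' : mfd R T' n).
Variables (f : T' -> T) (g : T -> T').
Hypotheses (pairZX : is_pair Z X) (pairZX' : is_pair Z' X').
Hypothesis fg_iso : inverse_pair_isos Z' X' Z X f g.

Let oZ : oriented_manifold Z. Proof. by have [] := pairZX. Qed.
Let oX : oriented_manifold X. Proof. by have [] := pairZX. Qed.
Let oZ' : oriented_manifold Z'. Proof. by have [] := pairZX'. Qed.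
Let oX' : oriented_manifold X'. Proof. by have [] := pairZX'. Qed.
Let XZ : carrier X `<=` carrier Z. Proof. by have [] := pairZX. Qed.
Let XZ' : carrier X' `<=` carrier Z'. Proof. by have [] := pairZX'. Qed.
Let fZ : set_fun (carrier Z') (carrier Z) f.
Proof. by have [[[]]] := fg_iso. Qed.
Let gZ : set_fun (carrier Z) (carrier Z') g.
Proof. by have [[[]]] := fg_iso. Qed.
Let fX : set_fun (carrier X') (carrier X) f.
Proof. by have [_ [[]]] := fg_iso. Qed.
Let gX : set_fun (carrier X) (carrier X') g.
Proof. by have [_ [[]]] := fg_iso. Qed.
Let gfK x : carrier Z' x -> g (f x) = x.
Proof. by have [[_ + _ _ _] _] := fg_iso; exact. Qed.
Let fgK y : carrier Z y -> f (g y) = y.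
Proof. by have [[_ _ + _ _] _] := fg_iso; exact. Qed.

Lemma iso_continuous : {within carrier Z', continuous f}.
Proof. by have [[_ _ _ sf _] _] := fg_iso; exact: or_smooth_continuous sf. Qed.

Lemma iso_complement :
  set_fun (carrier Z' `\` carrier X') (carrier Z `\` carrier X) f.
Proof.
move=> x [Zx nXx]; split; first exact: fZ.
by move=> /gX; rewrite gfK.
Qed.

Lemma iso_complement_continuous :
  {within carrier Z' `\` carrier X', continuous f}.
Proof. exact: continuous_subspaceW (@subDsetl _ _ _) iso_continuous. Qed.

(** Thus [pull_chart_positive], applied to [X'] and [X], also yields positivity of the charts
    induced on [X']. *)
Lemma head_pull_chart (c : chart R T (n + 3)) :
  head_chart (pull_chart f (carrier Z') c) (carrier X') =
  pull_chart f (carrier X') (head_chart c (carrier X)).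
Proof.
congr Chart; apply/seteqP; split=> x /=.
  by move=> [[_ cx] Xx]; split=> //; split=> //; exact: fX.
by move=> [Xx [cx _]]; split=> //; split=> //; exact: XZ'.
Qed.

Section Tubular.
Variable N : tub R T n.
Hypothesis tubN : tubular Z X N.
Let N' := pull_tub f g (carrier Z') N.

Lemma tub_proj_carrier x : tub_set N x -> carrier Z (tub_proj N x).
Proof. by have [_ pN _ _ _] := tubN; move=> /pN/XZ. Qed.

Lemma pull_bundle_chart c :
  tub_charts N c -> bundle_chart Z' X' N' (pull_chart f (carrier Z') c).
Proof.
have [_ pN _ chN _] := tubN.
move=> Nc; have [[pc phc] cE csub ctail csurj] := chN c Nc; split.
- split; first by have [fgZ _] := fg_iso; exact: pull_chart_positive fgZ pc.
  rewrite head_pull_chart.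
  by have [_ fgX] := fg_iso; exact: pull_chart_positive fgX phc.
(* Here and below [fgK] turns [f] of the new projection of [x] into the old projection of [f x], a
   point of [X] and hence of [Z]. *)
- apply/seteqP; split=> x /=.
    move=> [Zx]; rewrite {1}cE => -[Nx cpx]; do 2 split=> //.
      exact/gZ/tub_proj_carrier.
    by rewrite fgK //; exact: tub_proj_carrier.
  move=> [[Zx Nx] [_]]; rewrite fgK; last exact: tub_proj_carrier.
  by move=> cpx; split=> //; rewrite cE.
- move=> x /= [Zx cx]; move: (cx); rewrite {1}cE => -[Nx cpx].
  by rewrite fgK ?csub //; exact: tub_proj_carrier.
- by move=> x /= [Zx cx] Xx; apply: ctail => //; exact: fX.
- move=> x v /= [Zx cx] Xx; have [y [cy pyE yv]] := csurj _ v cx (fX Xx).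
  have Zy := tub_chart_carrier tubN Nc cy.
  exists (g y); split.
  + by split; [exact: gZ|rewrite /= fgK].
  + by rewrite /= fgK // pyE gfK.
  + by rewrite /tail /= fgK.
Qed.

(** The fibre coordinates of [q] in a pulled-back chart are those of [f q] in the original one, so
    the same orthogonal transition matrices serve. *)
Lemma pull_tubular : tubular Z' X' N'.
Proof.
have [XN pN covN chN trN] := tubN; split.
- by move=> x Xx; split; [exact: XZ'|exact/XN/fX].
- by move=> x [Zx Nx]; exact/gX/pN.
- move=> x [Zx Nx]; have [c Nc cx] := covN _ Nx.
  by exists (pull_chart f (carrier Z') c) => //; exists c.
- by move=> _ [c Nc <-]; exact: pull_bundle_chart.
- move=> _ _ p [c Nc <-] [d Nd <-] Xp [_ cp] [_ dp].
  have [A [AA AE]] := trN c d (f p) Nc Nd (fX Xp) cp dp.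
  exists A; split=> // q [Zq Nq] /= pq; apply: AE => //.
  rewrite -pq /= fgK //; exact: tub_proj_carrier.
Qed.

Lemma pull_sphere_bundle : sphere_bundle N' `<=` f @^-1` sphere_bundle N.
Proof. by move=> x [_ [[c Nc <-] [_ cx] norm1]]; exists c. Qed.

Let ff (u : T' * T') : T * T := (f u.1, f u.2).

Lemma pull_vertical_bundle :
  set_fun (vertical_bundle N') (vertical_bundle N) ff.
Proof.
move=> u [S1 [Z2 N2] /= pE [_ [[c Nc <-] [Z1 c1] orth]]]; split=> //=.
- exact: pull_sphere_bundle.
- have N1 : tub_set N (f u.1) by exact: (tub_chart_tub_set tubN) c1.
  rewrite -[LHS]fgK; last exact: tub_proj_carrier.
  by rewrite pE fgK //; exact: tub_proj_carrier.
- by exists c.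
Qed.

(** If [f u.2] were the zero vector over [f u.1], applying [g] would make [u.2] the zero vector over
    [u.1]. *)
Lemma pull_vertical_bundle_nz :
  set_fun (vertical_bundle_nz N') (vertical_bundle_nz N) ff.
Proof.
move=> u [vu nz]; split; first exact: pull_vertical_bundle.
move=> /= E; apply: nz => /=; rewrite -E gfK //.
by have [_ []] := vu.
Qed.

Lemma pull_vertical_bundle_continuous :
  {within vertical_bundle N', continuous ff}.
Proof.
have tubN' := pull_tubular.
apply: within_continuous_pair.
  apply: (within_continuous_comp (B := carrier Z')); last exact: iso_continuous.
    by move=> u [[_ [[c Nc <-] [Z1 _] _]] _ _ _].
  by apply: continuous_subspaceT => u; exact: cvg_fst.
apply: (within_continuous_comp (B := carrier Z')); last exact: iso_continuous.
  by move=> u [_ [Z2 _] _ _].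
by apply: continuous_subspaceT => u; exact: cvg_snd.
Qed.

(** For the normalization on fibres, the simplex [ff \o s] has in the chart [c] the coordinates of
    [s] in the pulled-back chart: the vertex matrix [a] and the orientation determinant are
    unchanged, so [u] takes the value 1. *)
Lemma pull_is_thom u : is_thom N u -> is_thom N' (cochain_pullback ff u).
Proof.
move=> [cu vu u1]; split.
- apply: cocycle_pullback cu; first exact: pull_vertical_bundle.
  exact: pull_vertical_bundle_continuous.
- apply: vanish_on_pullback vu; first exact: pull_vertical_bundle_nz.
  apply: continuous_subspaceW pull_vertical_bundle_continuous.
  exact: subIsetl.
move=> p _ a s Sp [c Nc <-] [Zp cp] sing sp aff zero pos.
apply: (u1 (f p) c a) => //.
- exact: pull_sphere_bundle.
- apply: singular_comp sing; first exact: pull_vertical_bundle.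
  exact: pull_vertical_bundle_continuous.
- by move=> t st; rewrite normalizeE //= sp.
- by move=> t st /=; rewrite normalizeE //=; exact: aff.
Qed.

End Tubular.

(** [ff] composed with the zero section of the new neighbourhood is the zero section of [N] composed
    with [f]. Hence [f] pulls the Euler cocycle of [N] back to that of [N'], and the identity
    defining e-classes is carried along. *)
Lemma e_classes_pullback (e : set (cochain R T 2 rat)) :
  e_classes Z X e ->
  e_classes Z' X' (pullback f (carrier Z' `\` carrier X') e).
Proof.
move=> [H2e [N [eps [tubN [u thomu ->] eN]]]]; split.
  exact: (H2_pullback iso_complement iso_complement_continuous).
pose N' := pull_tub f g (carrier Z') N.
have tubN' : tubular Z' X' N' by exact: pull_tubular.
pose u' := cochain_pullback (fun u : T' * T' => (f u.1, f u.2)) u.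
exists N', (cohomology_class (sphere_bundle N')
  (cochain_pullback (zero_section N') u')); split=> //.
  by exists u' => //; exact: pull_is_thom.
have SN' : sphere_bundle N' `<=` carrier Z' `\` carrier X'.
  exact: sphere_bundle_complement tubN'.
have cfS : {within sphere_bundle N', continuous f}.
  exact: continuous_subspaceW SN' iso_complement_continuous.
have [phi cphi eE] := H2e; move: eN; rewrite {}eE.
rewrite (restriction_class _ (sphere_bundle_complement tubN)).
rewrite rationalize_class => /cohomology_class_eqP eN.
rewrite (pullback_class _ iso_complement iso_complement_continuous).
rewrite (restriction_class _ SN') rationalize_class.
apply/cohomology_class_eqP.
apply: cohomologous_trans (cohomologous_pullback _ cfS eN) _.
  exact: pull_sphere_bundle.
(* The two Euler cocycles agree on every singular simplex of the new sphere bundle, where [fgK]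
   cancels the [f \o g] inside the projection. *)
apply: eq_cohomologous => s [_ sS _].
rewrite /cochain_pullback; congr ((u _)%:~R).
apply: eq_normalize => x xs /=.
rewrite !normalizeE //= /zero_section /= fgK //.
apply: (tub_proj_carrier tubN).
have [_ [[c Nc <-] [_ cx] _]] : sphere_bundle N' (s x) by apply: sS; exists x.
have [_ _ _ chN _] := tubN.
by have [_ cE _ _ _] := chN c Nc; move: cx; rewrite {1}cE => -[].
Qed.

End Transport.
End Pairs.

(** * Disjoint copies and the set of values of sigma *)

Section Copies.
Variable R : realType.

Definition copies_map (T T' : Type) (f : T -> T') (u : nat * T) : nat * T' :=
  (u.1, f u.2).

Lemma copies_covering_atlas (T : Type) n m (M : mfd R T n) :
  covering_atlas M -> covering_atlas (copies m M).
Proof.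
move=> [covM domM]; split=> [[i p] /= [im Mp]|_ [i [c [im Mc ->]]] [j p] /=].
  have [c Mc cp] := covM p Mp.
  by eexists; [exists i, c; split|].
by move=> [-> cp]; split=> //; exact: domM cp.
Qed.

Lemma boundary_covering_atlas (T : Type) n (M : mfd R T n.+1) :
  covering_atlas (boundary M).
Proof.
split=> [p bp|_ [c _ ->] p []//].
have [c [Mc _ cp _]] := bp.
by eexists; [exists c|].
Qed.

(** [copies_map f] keeps the index and the coordinates ignore it, so the local representatives of
    [f] serve unchanged. *)
Lemma copies_or_smooth (T T' : Type) n m (M : mfd R T n) (M' : mfd R T' n)
    (f : T -> T') :
  or_smooth M M' f -> or_smooth (copies m M) (copies m M') (copies_map f).
Proof.
move=> sf _ _ [i [c [_ Mc ->]]] [j [d [_ Md ->]]] [k p] /= [-> cp] [-> dfp].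
have [U [F [oU Up sF jF FE]]] := sf c d Mc Md p cp dfp.
by exists U, F; split=> // -[l q] /= [-> cq] Uq; have [] := FE q cq Uq.
Qed.

Lemma copies_inverse_diffeos (T T' : Type) n m (M : mfd R T n)
    (M' : mfd R T' n) (f : T -> T') (g : T' -> T) :
  inverse_diffeos M M' f g ->
  inverse_diffeos (copies m M) (copies m M') (copies_map f) (copies_map g).
Proof.
move=> [[fM gM] gf fg sf sg]; split.
- by split=> -[i p] /= [im Mp]; split=> //; [exact: fM|exact: gM].
- by move=> [i p] /= [_ Mp]; rewrite /copies_map /= gf.
- by move=> [i p] /= [_ Mp]; rewrite /copies_map /= fg.
- exact: copies_or_smooth.
- exact: copies_or_smooth.
Qed.

(** The witnesses [m], [b] and [s] are kept; only the isomorphism onto the boundary and its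
    compatibility with the classes change. The opposite inclusion is this lemma with [f] and [g]
    exchanged. *)
Lemma sigma_values_sub (T T' : ptopologicalType) (a : emfd R T 3)
    (a' : emfd R T' 3) (f : T' -> T) (g : T -> T') :
  is_pair (emfd_Z a) (emfd_X a) -> is_pair (emfd_Z a') (emfd_X a') ->
  inverse_pair_isos (emfd_Z a') (emfd_X a') (emfd_Z a) (emfd_X a) f g ->
  emfd_e a' =
    pullback f (carrier (emfd_Z a') `\` carrier (emfd_X a')) (emfd_e a) ->
  sigma_values a `<=` sigma_values a'.
Proof.
move=> pairZX pairZX' fg_iso eE r [m [U [b [s [m0 eb [h hiso hE] sgn rE]]]]].
exists m, U, b, s; split=> //.
have [fgZ fgX] := fg_iso.
have [oZ oX _ _] := pairZX; have [oZ' oX' _ _] := pairZX'.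
have fA := iso_complement fg_iso.
have cf := iso_complement_continuous pairZX pairZX' fg_iso.
set A := _ `\` _ in fA cf; set A' := carrier (emfd_Z a) `\` _ in fA.
pose mA := carrier (emfd_Z (ecopies m a')) `\` carrier (emfd_X (ecopies m a')).
pose mA' := carrier (emfd_Z (ecopies m a)) `\` carrier (emfd_X (ecopies m a)).
have sndA : set_fun mA A snd.
  by move=> [i p] [/= [im Zp] nX]; split=> // Xp; exact: nX.
have csnd : {within mA, continuous snd}.
  by apply: continuous_subspaceT => u; exact: cvg_snd.
have mapA : set_fun mA mA' (copies_map f).
  move=> [i p] mAp; have [Zp nXp] := fA p (sndA _ mAp).
  by have [[im _] _] := mAp; split=> // -[].
have cmap : {within mA, continuous (copies_map f)}.
  apply: within_continuous_pair; last exact: within_continuous_comp csnd cf.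
  by apply: continuous_subspaceT => u; exact: cvg_fst.
exists (h \o copies_map f).
  apply: (iso_pair_comp _ _ _ _ _ _ _ hiso);
    try exact/copies_covering_atlas/oriented_covering_atlas;
    try exact: boundary_covering_atlas.
  apply: (@inverse_pair_isos_iso_pair _ _ _ _ _ _ _ _ _ (copies_map g)).
  by split; exact: copies_inverse_diffeos.
(* Since [snd \o copies_map f] is [f \o snd], both sides become the pullback of [emfd_e a] along one
   map. *)
rewrite -(pullback_comp _ _ mapA cmap).
rewrite hE /= (pullback_comp _ _ mapA cmap) eE.
by rewrite (pullback_comp _ _ sndA csnd).
Qed.

End Copies.

(** * Invariance of e-classes and of sigma *)

Theorem corollary3 (R : realType) (T T' : ptopologicalType)
    (W : mfd R T 6) (V : mfd R T 3) (W' : mfd R T' 6) (V' : mfd R T' 3)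
    (hWV : @closed_pair R T 2 W V) (hWV' : @closed_pair R T' 2 W' V')
    (f : T' -> T) (hf : @iso_pair R T' T 3 W' V' W V f) :
  let fpull : set (cochain R T 2 rat) -> set (cochain R T' 2 rat) :=
    pullback f (carrier W' `\` carrier V')%classic in
  [/\ set_fun (H2 R (carrier W `\` carrier V)%classic rat)
              (H2 R (carrier W' `\` carrier V')%classic rat) fpull,
      set_bij (@e_classes R T 3 W V) (@e_classes R T' 3 W' V') fpull &
      forall e, @e_classes R T 3 W V e ->
        sigma_of W' V' (fpull e) = sigma_of W V e].

Proof.
move=> fpull.
have [pairWV _ _] := hWV; have [pairWV' _ _] := hWV'.
have [g fg_iso] := iso_pair_inverse pairWV' pairWV hf.
have gf_iso := inverse_pair_isos_sym fg_iso.
have [[_ gfK fgK _ _] _] := fg_iso.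
have fA := iso_complement fg_iso.
have cf := iso_complement_continuous pairWV pairWV' fg_iso.
have gA := iso_complement gf_iso.
have cg := iso_complement_continuous pairWV' pairWV gf_iso.
pose gpull : set (cochain R T' 2 rat) -> set (cochain R T 2 rat) :=
  pullback g (carrier W `\` carrier V)%classic.
(* [f \o g] is the identity on the complement of [V], and [pullback id] fixes elements of [H2];
   symmetrically for [gpullK]. *)
have fpullK e : H2 R (carrier W `\` carrier V)%classic rat e ->
    gpull (fpull e) = e.
  move=> He; rewrite /gpull /fpull (pullback_comp _ _ gA cg).
  rewrite -[RHS](pullback_id_H2 He); apply: eq_pullback => x.
  by rewrite inE => -[Wx _] /=; rewrite fgK.
have gpullK e : H2 R (carrier W' `\` carrier V')%classic rat e ->
    fpull (gpull e) = e.
  move=> He; rewrite /gpull /fpull (pullback_comp _ _ fA cf).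
  rewrite -[RHS](pullback_id_H2 He); apply: eq_pullback => x.
  by rewrite inE => -[Wx _] /=; rewrite gfK.
split; first exact: H2_pullback fA cf.
- split.
  + exact: e_classes_pullback fg_iso.
  + move=> e1 e2; rewrite !inE => -[H1 _] [H2' _] E.
    by rewrite -(fpullK e1) // -(fpullK e2) // E.
  + move=> e' he'; exists (gpull e').
      exact: e_classes_pullback gf_iso _ he'.
    by apply: gpullK; case: he'.
(* Both values of [sigma] are [xget 0] of a set of rationals, so they agree once the two sets are
   equal. *)
- move=> e [He _]; rewrite /sigma_of /sigma; congr xget.
  pose a : emfd R T 3 := @EMfd R T 3 W V e.
  pose a' : emfd R T' 3 := @EMfd R T' 3 W' V' (fpull e).
  apply/seteqP; split; last first.
    exact: (@sigma_values_sub _ _ _ a a' f g).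
  apply: (@sigma_values_sub _ _ _ a' a g f) => //=.
  (* For this inclusion along [g], the class [e] has to be the pullback of [fpull e]. *)
  by rewrite -/(gpull _) fpullK.
Qed.
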